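(* Fix integers $\delta,\Delta$ with $1\le\delta\le\Delta$. (i) There exists a graph $G$ with minimum degree $\delta$ and maximum degree $\Delta$ such that every rumor spreading algorithm requires $\Omega(\Delta/(\delta\cdot\phi))$ rounds in the mobile telephone model on $G$, where $\phi$ is the graph conductance of $G$. (ii) For every connected graph with minimum degree $\delta$, maximum degree $\Delta$ and graph conductance $\phi$, on $n$ vertices, the optimal rumor spreading algorithm terminates in $O(\Delta/(\delta\cdot\phi)\cdot\log n)$ rounds in the mobile telephone model.
   Context: For a graph $G=(V,E)$, $d(u)=|N(u)|$, $vol(S)=\sum_{u\in S}d(u)$, $cut(S,V\setminus S)$ is the number of edges with exactly one endpoint in $S$, and the graph conductance is $\phi=\min_{S\subseteq V,\,0<vol(S)\le vol(V)/2} cut(S,V\setminus S)/vol(S)$. Mobile telephone model (static topology): synchronous rounds; each node may send a connection proposal to at most one neighbor; a node that sends a proposal cannot receive one; a node that sent no proposal and received at least one may accept at most one; connected pairs exchange unbounded information. Rumor spreading: a single source starts with a rumor; solved once all nodes know it, information passing only across connections. *)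

(* Defs.v *)
From HB Require Import structures.
From mathcomp Require Import all_boot all_order all_algebra.
From mathcomp Require Import all_reals.

Set Implicit Arguments.
Unset Strict Implicit.
Unset Printing Implicit Defensive.

Import Order.TTheory GRing.Theory Num.Theory.
Local Open Scope ring_scope.

Record sgraph := SGraph {
  vertex :> finType;
  edge : rel vertex;
  edge_sym : symmetric edge;
  edge_irr : irreflexive edge
}.

Section Graphs.
Variable G : sgraph.

Definition neighbors (u : G) : {set G} := [set v | edge u v].

Definition deg (u : G) : nat := #|neighbors u|.

(* Every degree is below #|G|, so the default value #|G| is reached only by
   the graph without vertices. *)
Definition min_degree : nat := \big[minn/#|G|]_(u : G) deg u.

Definition max_degree : nat := \max_(u : G) deg u.

Definition connected_graph : Prop := forall u v : G, connect (@edge G) u v.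

Definition vol (S : {set G}) : nat := (\sum_(u in S) deg u)%N.

(* An edge with exactly one endpoint in S is counted once, as the ordered pair
   starting at that endpoint. *)
Definition cut (S : {set G}) : nat :=
  #|[set p : G * G | [&& edge p.1 p.2, p.1 \in S & p.2 \notin S]]|.

(* All the ratios are at most 1, and in a graph with an edge uv the set [set u]
   is admissible; so the default value 1 matters only for edgeless graphs. *)
Definition conductance (R : realType) : R :=
  \big[Num.min/1]_(S : {set G} | (0 < vol S)%N && ((vol S).*2 <= vol [set: G])%N)
    ((cut S)%:R / (vol S)%:R).

End Graphs.

(* A distributed algorithm for the mobile telephone model on G.  The code of a
   node may depend on G and on the node.  A node is initialised with the flag
   telling whether it is the source, and with its private infinite tape of
   random bits; deterministic algorithms are those that ignore the tape.  In
   each round node u with state s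
   - sends a proposal to propose u s (if any), which is a neighbor;
   - when P is the set of proposals received, accepts accept u s P (if any);
   - moves to next u s P c, where c is the identity and the whole current state
     of the node it got connected with, if any (exchange of unbounded
     information). *)
Record algorithm (G : sgraph) := Algorithm {
  state : Type;
  init : G -> bool -> (nat -> bool) -> state;
  propose : G -> state -> option G;
  accept : G -> state -> {set G} -> option G;
  next : G -> state -> {set G} -> option (G * state) -> state;
  propose_neighbor : forall u s v, propose u s = Some v -> edge u v;
  accept_received : forall u s P v, accept u s P = Some v -> v \in P
}.

Section Execution.
Variables (G : sgraph) (A : algorithm G).

Definition configuration := G -> state A.

Definition sent (c : configuration) (u : G) : option G := propose u (c u).

(* A node that sends a proposal receives none. *)
Definition received (c : configuration) (u : G) : {set G} :=
  if sent c u is Some _ then set0 else [set v | sent c v == Some u].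

Definition accepted (c : configuration) (u : G) : option G :=
  accept u (c u) (received c u).

(* Since accepted c u \in received c u, a node accepts only if it sent no
   proposal; hence the connections of a round form a matching. *)
Definition partner (c : configuration) (u : G) : option G :=
  if sent c u is Some v then
    if accepted c v == Some u then Some v else None
  else accepted c u.

Definition step (c : configuration) : configuration :=
  fun u => next u (c u) (received c u)
             (omap (fun v => (v, c v)) (partner c u)).

Variables (source : G) (coins : G -> nat -> bool).

Fixpoint config (t : nat) : configuration :=
  if t is t'.+1 then step (config t')
  else fun u => init A u (u == source) (coins u).

Fixpoint informed (t : nat) : {set G} :=
  if t is t'.+1 then
    informed t' :|:
    [set u | if partner (config t') u is Some v then v \in informed t'
             else false]
  else [set source].

Definition solved (t : nat) : Prop := informed t = [set: G].

End Execution.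

Definition solves_within (G : sgraph) (A : algorithm G) (t : nat) : Prop :=
  forall (source : G) (coins : G -> nat -> bool), solved A source coins t.

(* Optimality is for the worst-case number of rounds, over all sources and all
   outcomes of the random bits. *)
Definition optimal (G : sgraph) (A : algorithm G) : Prop :=
  forall (B : algorithm G) (t : nat), solves_within B t -> solves_within A t.

(* Main.v *)
(* (i) In the complete bipartite graph K_(delta, Delta) every connection uses
   one of the delta nodes of the small side, so a round informs at most delta
   new nodes, whereas the conductance is at least 1/2.

   (ii) A maximal matching across the cut of S has at least
   cut(S) / (2 Delta) edges.  Put alpha = phi delta / (2 Delta).  Spreading
   from a root along such matchings multiplies the number of informed nodes by
   at least 1 + alpha as long as they carry at most half of the volume, and
   then multiplies the number of uninformed nodes by at most 1 - alpha; so
   O(log n / alpha) rounds suffice.  As nodes do not know the source, the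
   schedule is first run backwards, which gathers the rumor at the root. *)
Require Import Defs.
From HB Require Import structures.
From mathcomp Require Import all_boot all_order all_algebra.
From mathcomp Require Import boolp all_reals exp.
From mathcomp Require Import zify ring lra.

Set Implicit Arguments.
Unset Strict Implicit.
Unset Printing Implicit Defensive.

Import Order.TTheory GRing.Theory Num.Theory.
Local Open Scope ring_scope.

(** * Volumes and cuts as counts of ordered adjacent pairs *)

Lemma card_dep_pairs (T : finType) (P : pred T) (Q : rel T) :
  #|[set p : T * T | P p.1 && Q p.1 p.2]| = (\sum_(u | P u) #|[set v | Q u v]|)%N.
Proof.
rewrite -sum1_card; under [RHS]eq_bigr do rewrite -sum1_card.
rewrite pair_big_dep /=; apply: eq_bigl => -[u v]; by rewrite !inE.
Qed.

Lemma swap_pair_inj (T : Type) : injective (fun p : T * T => (p.2, p.1)).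
Proof. by move=> [a b] [c d] [-> ->]. Qed.

Section GraphTheory.
Variable G : sgraph.
Implicit Types (u v : G) (S : {set G}).

Lemma card_arcs S : #|[set p : G * G | (p.1 \in S) && edge p.1 p.2]| = vol S.
Proof. exact: (card_dep_pairs (mem S) (@edge G)). Qed.

Lemma cutE S : cut S = (\sum_(u in S) #|neighbors u :\: S|)%N.
Proof.
transitivity #|[set p : G * G | (p.1 \in S) && (p.2 \in neighbors p.1 :\: S)]|.
  apply: eq_card => -[u v]; rewrite !inE /=.
  by case: (u \in S); case: (v \in S); case: (edge u v).
rewrite (card_dep_pairs (mem S) (fun u v => v \in neighbors u :\: S)).
by apply: eq_bigr => u _; apply: eq_card => v; rewrite inE.
Qed.

Lemma cutC S : cut (~: S) = cut S.
Proof.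
rewrite /cut -(card_imset _ (@swap_pair_inj G)); apply: eq_card => -[u v].
rewrite !inE /=; apply/imsetP/and3P => [[[a b]] |[uv uS vS]].
  rewrite !inE /= negbK => /and3P[ab aS bS] [-> ->]; split=> //.
  by rewrite edge_sym.
exists (v, u) => //; rewrite !inE /= uS vS edge_sym uv //.
Qed.

Lemma min_degree_le u : (min_degree G <= deg u)%N.
Proof.
rewrite /min_degree; have := mem_index_enum u.
elim: (index_enum _) => //= v s IH; rewrite inE big_cons geq_min.
by case/orP=> [/eqP ->|/IH ->]; rewrite ?leqnn ?orbT.
Qed.

Lemma leq_max_degree u : (deg u <= max_degree G)%N.
Proof. exact: (leq_bigmax (F := @deg G)). Qed.

Lemma vol_ge_card S : (min_degree G * #|S| <= vol S)%N.
Proof.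
rewrite mulnC -sum_nat_const; apply: leq_sum => u _; exact: min_degree_le.
Qed.

Lemma vol_le_card S : (vol S <= max_degree G * #|S|)%N.
Proof.
rewrite mulnC -sum_nat_const; apply: leq_sum => u _; exact: leq_max_degree.
Qed.

Lemma volC S : (vol S + vol (~: S) = vol [set: G])%N.
Proof.
rewrite /vol (bigID (mem S) (fun u => u \in [set: G])) /=.
by congr addn; apply: eq_bigl => u; rewrite !inE.
Qed.

Lemma volS (A B : {set G}) : A \subset B -> (vol A <= vol B)%N.
Proof.
move=> AB; rewrite /vol [leqRHS](big_setID A) /= (setIidPr AB); exact: leq_addr.
Qed.

(** If no edge left [S], then [S] would be closed under [edge], hence under [connect]. *)
Lemma cut_gt0 S u v :
  connected_graph G -> u \in S -> v \notin S -> (0 < cut S)%N.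
Proof.
move=> conG uS vS; rewrite lt0n; apply/eqP => cut0.
have /closed_connect clS : closed (@edge G) (mem S).
  apply: intro_closed => [x y|x y xy xS]; first by apply: sym_connect_sym; exact: edge_sym.
  apply/negPn/negP => yS.
  by move/cards0_eq/setP/(_ (x, y)): cut0; rewrite !inE /= xy yS xS.
have E : (u \in S) = (v \in S) := clS _ _ (conG u v).
by rewrite uS (negbTE vS) in E.
Qed.

End GraphTheory.

(** * Conductance and its positivity on connected graphs *)

Section Conductance.
Variables (R : realType) (G : sgraph).
Implicit Type S : {set G}.
Local Notation phi := (conductance G R).

Lemma conductance_le1 : phi <= 1.
Proof. exact: bigmin_le_id. Qed.

Lemma conductance_le_cut S :
  ((vol S).*2 <= vol [set: G])%N -> phi * (vol S)%:R <= (cut S)%:R.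
Proof.
move=> vS; have [->|v0] := posnP (vol S); first by rewrite mulr0.
rewrite -ler_pdivlMr ?ltr0n //.
by apply: (@bigmin_le_cond _ _ _ _ S); rewrite v0 vS.
Qed.

(** The volume bounds make [S] and its complement both nonempty, so every ratio in the minimum has a
    positive cut. *)
Lemma conductance_gt0 : connected_graph G -> 0 < phi.
Proof.
move=> conG; apply: (big_ind (fun x : R => 0 < x)) => // [x y x0 y0|S].
  by rewrite lt_min x0 y0.
case/andP=> v0 v2; apply: divr_gt0; rewrite ltr0n //.
have [u uS] : exists u, u \in S.
  by apply/set0Pn; apply: contraTneq v0 => ->; rewrite /vol big_set0.
have [v vS] : exists v, v \in ~: S.
  apply/set0Pn; apply: contraTneq v2 => SC; have := volC S.
  rewrite SC {2}/vol big_set0; lia.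
by apply: (cut_gt0 conG uS (v := v)); move: vS; rewrite inE.
Qed.

End Conductance.

(** * Connections and informed sets in an arbitrary execution *)

Section ExecutionTheory.
Variables (G : sgraph) (A : algorithm G).
Implicit Type c : configuration A.

(** A node that proposed has an empty [received], so the acceptor of a proposal sent none and its
    [partner] is the node it accepts. *)
Lemma partner_sym c u v : partner c u = Some v -> partner c v = Some u.
Proof.
rewrite {1}/partner; case su: (sent c u) => [w|].
  case: eqP => // aw [<-].
  have := accept_received aw; rewrite /received /partner.
  by case: (sent c w) => //; rewrite inE.
move=> auv; have := accept_received auv; rewrite /received su inE => /eqP sv.
by rewrite /partner sv auv eqxx.
Qed.

Lemma partner_edge c u v : partner c u = Some v -> edge u v.
Proof.
rewrite /partner; case su: (sent c u) => [w|].
  by case: eqP => // _ [<-]; exact: propose_neighbor su.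
move=> auv; have := accept_received auv; rewrite /received su inE => /eqP sv.
by rewrite edge_sym; exact: propose_neighbor sv.
Qed.

Lemma informed_mono source coins t t' :
  (t <= t')%N -> informed A source coins t \subset informed A source coins t'.
Proof.
move/subnK <-; elim: (t' - t)%N => //= k IH.
exact: (subset_trans IH (subsetUl _ _)).
Qed.

Lemma solved_mono source coins t t' :
  (t <= t')%N -> solved A source coins t -> solved A source coins t'.
Proof.
move=> /(informed_mono source coins) + st; rewrite {}st => sub.
by apply/eqP; rewrite eqEsubset subsetT.
Qed.

(* Every connection uses a node of L, and a node of L serves only one newly
   informed node. *)
Lemma card_informed_cover (L : {set G}) source coins t :
  (forall u v : G, edge u v -> (u \in L) || (v \in L)) ->
  (#|informed A source coins t| <= 1 + t * #|L|)%N.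
Proof.
move=> cover; elim: t => [|t IH]; first by rewrite /= cards1.
set I := informed A source coins t; set c := config A source coins t.
have -> : informed A source coins t.+1 =
  I :|: (informed A source coins t.+1 :\: I).
  by rewrite setDE setUIr setUCr setIT /= setUA setUid.
set N := _ :\: I.
apply: leq_trans (leq_card_setU _ _) _.
suff: (#|N| <= #|L|)%N by move: IH; rewrite -/I; lia.
have partN u : u \in N -> exists2 v, partner c u = Some v & v \in I.
  rewrite !inE -/I -/c => /andP[/negbTE-> /=].
  by case: (partner c u) => [v|//] vI; exists v.
have NI u : u \in N -> u \notin I by rewrite inE => /andP[].
(* Charge a newly informed node to an end of its connection in [L]. No two are charged alike: their
   partners are already informed, hence not new, and connections are symmetric. *)
pose f u := if u \in L then u else odflt u (partner c u).
have f_inj : {in N &, injective f}.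
  move=> u v uN vN; rewrite /f.
  have [u' pu u'I] := partN u uN; have [v' pv v'I] := partN v vN.
  rewrite pu pv /=; case: ifP => _; case: ifP => _ // E.
  - by have := NI u uN; rewrite E v'I.
  - by have := NI v vN; rewrite -E u'I.
  - by have := partner_sym pu; rewrite E (partner_sym pv) => -[].
rewrite -(card_in_imset f_inj); apply/subset_leq_card/subsetP => _ /imsetP[u uN ->].
have [u' pu _] := partN u uN; rewrite /f pu /=.
by have := cover _ _ (partner_edge pu); case: ifP.
Qed.

End ExecutionTheory.

(** * The complete bipartite graph: degrees and conductance *)

Section CompleteBipartite.
Variables m n : nat.

Definition in_left (x : 'I_m + 'I_n) := if x is inl _ then true else false.

Definition biclique_edge : rel ('I_m + 'I_n) :=
  fun x y => in_left x != in_left y.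

Lemma biclique_sym : symmetric biclique_edge.
Proof. by move=> x y; rewrite /biclique_edge eq_sym. Qed.

Lemma biclique_irr : irreflexive biclique_edge.
Proof. by move=> x; rewrite /biclique_edge eqxx. Qed.

Definition biclique : sgraph := SGraph biclique_sym biclique_irr.

Implicit Type S : {set biclique}.

Lemma card_sum_set S :
  #|S| = (#|[set i | inl i \in S]| + #|[set j | inr j \in S]|)%N.
Proof.
rewrite -!sum1_card big_sumType /=.
by congr addn; apply: eq_bigl => i; rewrite inE.
Qed.

Lemma biclique_deg_inl i : @deg biclique (inl i) = n.
Proof.
rewrite /deg card_sum_set (_ : [set _ | _] = set0) ?cards0 ?add0n.
  by rewrite (_ : [set _ | _] = setT) ?cardsT ?card_ord //;
    apply/setP=> j; rewrite !inE.
by apply/setP=> j; rewrite !inE.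
Qed.

Lemma biclique_deg_inr j : @deg biclique (inr j) = m.
Proof.
rewrite /deg card_sum_set addnC (_ : [set _ | _] = set0) ?cards0 ?add0n.
  by rewrite (_ : [set _ | _] = setT) ?cardsT ?card_ord //;
    apply/setP=> i; rewrite !inE.
by apply/setP=> i; rewrite !inE.
Qed.

Lemma biclique_vol S :
  vol S = (#|[set i | inl i \in S]| * n + #|[set j | inr j \in S]| * m)%N.
Proof.
rewrite /vol big_sumType /= -!sum_nat_const.
congr addn; rewrite [RHS](eq_bigl _ _ (fun x => in_set _ x)); apply: eq_bigr => i _.
- exact: biclique_deg_inl.
- exact: biclique_deg_inr.
Qed.

Lemma biclique_cut S :
  cut S = (#|[set i | inl i \in S]| * (n - #|[set j | inr j \in S]|)
         + #|[set j | inr j \in S]| * (m - #|[set i | inl i \in S]|))%N.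
Proof.
rewrite cutE big_sumType /= -!sum_nat_const.
congr addn; rewrite [RHS](eq_bigl _ _ (fun x => in_set _ x)); apply: eq_bigr => i _;
  rewrite card_sum_set.
- rewrite (_ : [set _ | _] = set0) ?cards0 ?add0n; last first.
    by apply/setP=> j; rewrite !inE andbF.
  rewrite (_ : [set _ | _] = ~: [set j | inr j \in S]); last first.
    by apply/setP=> j; rewrite !inE andbT.
  by rewrite cardsCs setCK card_ord.
- rewrite addnC (_ : [set _ | _] = set0) ?cards0 ?add0n; last first.
    by apply/setP=> j; rewrite !inE andbF.
  rewrite (_ : [set _ | _] = ~: [set j | inl j \in S]); last first.
    by apply/setP=> j; rewrite !inE andbT.
  by rewrite cardsCs setCK card_ord.
Qed.

Lemma biclique_connected : (0 < m)%N -> (0 < n)%N -> connected_graph biclique.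
Proof.
move=> m0 n0 [i|j] [i'|j'].
- by apply: (@connect_trans _ _ (inr (Ordinal n0))); exact: connect1.
- exact: connect1.
- exact: connect1.
- by apply: (@connect_trans _ _ (inl (Ordinal m0))); exact: connect1.
Qed.

Lemma biclique_min_degree : (0 < n)%N -> (m <= n)%N -> min_degree biclique = m.
Proof.
move=> n0 mn; apply/eqP; rewrite eqn_leq; apply/andP; split.
  by rewrite -(biclique_deg_inr (Ordinal n0)); exact: min_degree_le.
apply: (big_ind (fun x => (m <= x)%N)) => [|x y mx my|[i|j] _].
- by rewrite card_sum card_ord leq_addr.
- by rewrite leq_min mx my.
- by rewrite biclique_deg_inl.
- by rewrite biclique_deg_inr.
Qed.

Lemma biclique_max_degree : (0 < m)%N -> (m <= n)%N -> max_degree biclique = n.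
Proof.
move=> m0 mn; apply/eqP; rewrite eqn_leq; apply/andP; split.
  by apply/bigmax_leqP => -[i|j] _; rewrite ?biclique_deg_inl ?biclique_deg_inr.
by rewrite -(biclique_deg_inl (Ordinal m0)); exact: leq_max_degree.
Qed.

(** With [a] and [b] nodes of [S] on the two sides, [vol S] is [a n + b m] and [cut S] is
    [a n + b m - 2 a b], so the bound amounts to [4 a b <= a n + b m]. *)
Lemma biclique_conductance (R : realType) : 1 / 2 <= conductance biclique R.
Proof.
apply: (big_ind (fun x : R => 1 / 2 <= x)) => [|x y hx hy|S]; first by lra.
  by rewrite le_min hx hy.
case/andP=> v0 v2; rewrite ler_pdivlMr ?ltr0n //.
suff: (vol S <= 2 * cut S)%N by rewrite -(ler_nat R) natrM; lra.
move: v0 v2; rewrite biclique_cut !biclique_vol.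
set a := #|_|; set b := #|_|.
have am : (a <= m)%N by rewrite -[leqRHS](card_ord m) max_card.
have bn : (b <= n)%N by rewrite -[leqRHS](card_ord n) max_card.
have -> : #|[set i | inl i \in [set: biclique]]| = m.
  by rewrite (_ : [set _ | _] = setT) ?cardsT ?card_ord //;
    apply/setP=> j; rewrite !inE.
have -> : #|[set i | inr i \in [set: biclique]]| = n.
  by rewrite (_ : [set _ | _] = setT) ?cardsT ?card_ord //;
    apply/setP=> j; rewrite !inE.
move=> v0 v2.
have vmn : (a * n + b * m <= m * n)%N by lia.
(* AM-GM: [4 (a n) (b m) <= (a n + b m) ^ 2 <= (a n + b m) (m n)] *)
have amgm : (4 * (a * b) * (m * n) <= (a * n + b * m) * (m * n))%N.
  apply: (@leq_trans ((a * n + b * m) ^ 2)%N); last by rewrite leq_mul2l vmn orbT.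
  have := sqr_ge0 ((a * n)%:Z - (b * m)%:Z); nia.
have mn0 : (0 < m * n)%N by nia.
by move: amgm; rewrite leq_pmul2r //; nia.
Qed.

End CompleteBipartite.

(** * Algorithms that follow a fixed sequence of matchings *)

Section Schedules.
Variable G : sgraph.
Implicit Types (u v : G) (S : {set G}) (m : {ffun G -> G}) (ms : seq {ffun G -> G}).

(* A matching is encoded as an involution, whose fixed points are the
   unmatched nodes. *)
Definition matching m :=
  [forall u, (m (m u) == u) && ((m u != u) ==> edge u (m u))].

Lemma matchingK m : matching m -> involutive m.
Proof. by move=> /forallP mm u; have /andP[/eqP] := mm u. Qed.

Lemma matching_edge m u : matching m -> m u != u -> edge u (m u).
Proof. by move=> /forallP/(_ u)/andP[_ /implyP]. Qed.

(** The informed set after a round whose connections are the pairs of [m]; a preimage serves, as [m]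
    is an involution. *)
Definition spread1 S m : {set G} := [set u | (u \in S) || (m u \in S)].

Definition spread S ms : {set G} := foldl spread1 S ms.

Lemma spread_rcons S ms m : spread S (rcons ms m) = spread1 (spread S ms) m.
Proof. exact: foldl_rcons. Qed.

Lemma spreadU S S' ms : spread (S :|: S') ms = spread S ms :|: spread S' ms.
Proof.
elim: ms S S' => //= m ms IH S S'; rewrite -IH; congr spread.
by apply/setP => u; rewrite !inE orbACA.
Qed.

Lemma spreadS S S' ms : S \subset S' -> spread S ms \subset spread S' ms.
Proof. by move=> /setUidPr <-; rewrite spreadU subsetUl. Qed.

(** Matchings are symmetric, so a route of the rumor read backwards is a route through the reversed
    sequence. *)
Lemma spread_rev u v ms : all matching ms ->
  (v \in spread [set u] (rev ms)) = (u \in spread [set v] ms).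
Proof.
elim: ms u v => [|m ms IH] u v /=; first by rewrite !inE eq_sym.
case/andP=> mm mms; rewrite rev_cons spread_rcons inE !IH //.
have -> : spread1 [set v] m = [set v] :|: [set m v].
  by apply/setP=> x; rewrite !inE (can2_eq (matchingK mm) (matchingK mm)).
by rewrite spreadU inE.
Qed.

(** Past the end of [ms] the default sends [u] to itself, and irreflexivity of [edge] then prevents
    a proposal. *)
Definition schedule_propose ms u (s : nat) : option G :=
  let v := nth [ffun=> u] ms s u in
  if edge u v && (enum_rank u < enum_rank v)%N then Some v else None.

Lemma schedule_propose_edge ms u s v :
  schedule_propose ms u s = Some v -> edge u v.
Proof. by rewrite /schedule_propose; case: ifP => // /andP[uv _] [<-]. Qed.

Definition schedule_accept ms u (s : nat) (P : {set G}) : option G :=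
  let v := nth [ffun=> u] ms s u in if v \in P then Some v else None.

Lemma schedule_accept_received ms u s P v :
  schedule_accept ms u s P = Some v -> v \in P.
Proof. by rewrite /schedule_accept; case: ifP => // vP [<-]. Qed.

(* The state only counts the rounds; of two matched nodes, the one of smaller
   rank proposes. *)
Definition schedule ms : algorithm G :=
  Algorithm (fun _ _ _ => 0%N) (fun _ s _ _ => s.+1)
    (@schedule_propose_edge ms) (@schedule_accept_received ms).

Lemma schedule_config ms source coins t :
  config (schedule ms) source coins t = fun=> t.
Proof. by elim: t => //= t ->. Qed.

Lemma schedule_partner ms (t : nat) u : all matching ms -> (t < size ms)%N ->
  partner (A := schedule ms) (fun=> t) u =
  let v := nth [ffun=> u] ms t u in if v == u then None else Some v.
Proof.
move=> mms tms.
set m := nth [ffun=> u] ms t; have mE v : nth [ffun=> v] ms t = m by exact: set_nth_default.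
have mm : matching m by move/all_nthP: mms; apply.
have sentE v : sent (A := schedule ms) (fun=> t) v =
    if edge v (m v) && (enum_rank v < enum_rank (m v))%N then Some (m v) else None.
  by rewrite /sent /= /schedule_propose mE.
have acceptE v P : accept (a := schedule ms) v t P = if m v \in P then Some (m v) else None.
  by rewrite /= /schedule_accept mE.
have mK := matchingK mm.
(* The proposal of [m v] arrives exactly when [m v] has the smaller rank, and then [v] itself sent
   nothing. *)
have receivedE v : (m v \in received (A := schedule ms) (fun=> t) v) =
    (m v != v) && (enum_rank (m v) < enum_rank v)%N.
  rewrite /received; have [mv|mv] := eqVneq (m v) v.
    by case E: (sent _ _) => [w|]; rewrite inE // mv E.
  have vm := matching_edge mm mv; have mvv : edge (m v) v by rewrite edge_sym.
  have sv := sentE v; rewrite vm andTb in sv; rewrite {}sv.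
  case: ltngtP => rk; rewrite inE ?andbF // sentE mK mvv ?rk ?eqxx //.
  by case/eqP: mv; apply/esym/enum_rank_inj/val_inj.
rewrite /partner /accepted acceptE receivedE sentE.
have [->|mu] := eqVneq (m u) u; first by rewrite edge_irr.
have um := matching_edge mm mu; rewrite um andTb.
case: ltngtP => rk //.
- by rewrite acceptE receivedE mK (eq_sym u) mu rk eqxx.
- by case/eqP: mu; apply/esym/enum_rank_inj/val_inj.
Qed.

Lemma schedule_informed ms source coins : all matching ms ->
  informed (schedule ms) source coins (size ms) = spread [set source] ms.
Proof.
move=> mms; suff H t : (t <= size ms)%N ->
    informed (schedule ms) source coins t = spread [set source] (take t ms).
  by rewrite H // take_size.
elim: t => [|t IH] tms /=; first by rewrite take0.
rewrite IH ?(ltnW tms) // (take_nth [ffun=> source]) // spread_rcons.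
apply/setP => u; rewrite !inE schedule_config schedule_partner //=.
have -> : nth [ffun=> source] ms t = nth [ffun=> u] ms t by exact: set_nth_default.
by case: (eqVneq _ u) => [->|]; rewrite ?orbF ?orbb.
Qed.

(* Reversing a broadcast from [root] gathers the rumor at [root] from wherever
   it starts, so the source need not be known. *)
Lemma solves_gather_broadcast root ms : all matching ms ->
  spread [set root] ms = [set: G] ->
  solves_within (schedule (rev ms ++ ms)) (size ms + size ms).
Proof.
move=> mms full source coins.
have := schedule_informed source coins (ms := rev ms ++ ms).
rewrite all_cat all_rev mms size_cat size_rev /solved => -> //.
rewrite /spread foldl_cat -!/(spread _ _).
apply/eqP; rewrite eqEsubset subsetT -full; apply: spreadS.
by rewrite sub1set spread_rev // full inE.
Qed.

(** Take a crossing matching with the most newly informed nodes [N]. By maximality every arc of the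
    cut touches [N] or the set [m @: N] of partners, each of [#|N|] nodes with at most
    [max_degree G] arcs per node. *)
Lemma matching_across_cut S : exists2 m, matching m &
  (cut S <= (max_degree G).*2 * #|spread1 S m :\: S|)%N.
Proof.
(* When every matched pair crosses, a matched node outside [S] is newly informed, and a matched node
   of [S] is the partner of such a node. *)
pose crossing m := matching m && [forall u, (m u != u) ==> ((u \in S) != (m u \in S))].
pose id := [ffun u : G => u].
have id_cross : crossing id.
  by apply/andP; split; apply/forallP=> u; rewrite !ffunE eqxx.
have [m /andP[mm /forallP mS] m_max] := arg_maxnP (fun m => #|spread1 S m :\: S|) id_cross.
have mK := matchingK mm.
exists m => //; set N := _ :\: S in m_max *.
(* Otherwise uv could be added to the maximal m. *)
have free u v : edge u v -> u \in S -> v \notin S -> (v \in N) || (u \in m @: N).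
  move=> uv uS vS; apply/negPn/negP; rewrite negb_or => /andP[vN uN].
  have vm : m v = v.
    apply/eqP/negPn/negP => mv; move: vN; have := mS v.
    by rewrite !inE mv (negbTE vS) /=; case: (m v \in S).
  have um : m u = u.
    apply/eqP/negPn/negP => mu; case/negP: uN; have := mS u; rewrite mu uS /= => muS.
    by rewrite -[u]mK imset_f // !inE mK uS orbT andbT; move: muS; case: (m u \in S).
  have nuv : u != v by apply: contraNneq vS => <-.
  pose m' := [ffun x => if x == u then v else if x == v then u else m x].
  have m'E x : x != u -> x != v -> [/\ m' x = m x, m x != u & m x != v].
    move=> xu xv; rewrite ffunE (negbTE xu) (negbTE xv); split=> //.
    - by apply: contra xu => /eqP E; rewrite -[x]mK E um.
    - by apply: contra xv => /eqP E; rewrite -[x]mK E vm.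
  have m'u : m' u = v by rewrite ffunE eqxx.
  have m'v : m' v = u by rewrite ffunE eq_sym (negbTE nuv) eqxx.
  have m'_cross : crossing m'.
    apply/andP; split; apply/forallP=> x;
      (have [->|xu] := eqVneq x u; [|have [->|xv] := eqVneq x v;
        [|have [-> mxu mxv] := m'E x xu xv]]).
    - by rewrite m'u m'v eqxx uv implybT.
    - by rewrite m'v m'u eqxx edge_sym uv implybT.
    - have [-> _ _] := m'E _ mxu mxv; rewrite mK eqxx.
      by apply/implyP; exact: matching_edge.
    - by rewrite m'u uS (negbTE vS) implybT.
    - by rewrite m'v uS (negbTE vS) implybT.
    - exact: mS.
  (* Under [m'] the node [v] is new, and all of [N], which avoids [v], stays new: this contradicts
     the choice of [m]. *)
  have := m_max _ m'_cross; apply/negP; rewrite -ltnNge.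
  have vN' : v \in spread1 S m' :\: S by rewrite !inE m'v uS vS orbT.
  rewrite [leqRHS](cardsD1 v) vN' add1n ltnS; apply/subset_leq_card/subsetP => x xN.
  have xv : x != v by apply: contraNneq vN => <-.
  have xu : x != u by apply: contraTneq xN => ->; rewrite inE uS.
  by move: xN; rewrite !inE xv; have [-> _ _] := m'E x xu xv.
pose arcs (B : {set G}) := [set p : G * G | (p.1 \in B) && edge p.1 p.2].
have sub : [set p : G * G | [&& edge p.1 p.2, p.1 \in S & p.2 \notin S]]
    \subset [set (p.2, p.1) | p in arcs N] :|: arcs (m @: N).
  apply/subsetP => -[u v]; rewrite !inE /= => /and3P[uv uS vS].
  have /orP[vN|->] := free u v uv uS vS; last by rewrite uv orbT.
  by apply/orP; left; apply/imsetP; exists (v, u) => //; rewrite inE /= vN edge_sym.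
apply: leq_trans (subset_leq_card sub) _; apply: leq_trans (leq_card_setU _ _) _.
rewrite (card_imset _ (@swap_pair_inj G)) !card_arcs.
have := vol_le_card N; have := vol_le_card (m @: N).
by rewrite card_imset ?card_in_imset //; [lia | exact: inv_inj].
Qed.

End Schedules.

Arguments matching {G} m.

(** * Growth of the informed set and the number of rounds *)

Section Broadcast.
Variables (R : realType) (G : sgraph).
Hypotheses (conG : connected_graph G) (min_gt0 : (0 < min_degree G)%N).
Implicit Types (S : {set G}) (ms : seq {ffun G -> G}).
Local Notation phi := (conductance G R).
Local Notation alpha := (phi * (min_degree G)%:R / ((max_degree G).*2)%:R).
Local Notation heavy S := (vol [set: G] <= (vol S).*2)%N.

Lemma card_spread1 S (m : {ffun G -> G}) :
  #|spread1 S m| = (#|S| + #|spread1 S m :\: S|)%N.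
Proof.
rewrite -(cardsID S) (setIidPr _) //.
by apply/subsetP => u; rewrite inE => ->.
Qed.

(** The bound [gain] chains the matching bound, the conductance and the minimum degree. It is
    applied to [S] in the light case and to its complement, which has the same cut, in the heavy
    case. *)
Lemma spread1_growth S : (0 < max_degree G)%N -> exists2 m, matching m &
  (((vol S).*2 <= vol [set: G])%N -> (1 + alpha) * #|S|%:R <= #|spread1 S m|%:R)
  /\ (heavy S -> #|~: spread1 S m|%:R <= (1 - alpha) * #|~: S|%:R).
Proof.
move=> max_gt0; have [m mm cutN] := matching_across_cut S; exists m => //.
set N := #|_ :\: _| in cutN.
have gain (S' : {set G}) : ((vol S').*2 <= vol [set: G])%N -> cut S' = cut S ->
    alpha * #|S'|%:R <= N%:R.
  move=> /conductance_le_cut -/(_ R) cond cutS'.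
  rewrite mulrAC ler_pdivrMr; last by rewrite ltr0n double_gt0.
  apply: (@le_trans _ _ (cut S)%:R); last by rewrite -natrM ler_nat mulnC.
  rewrite -cutS'; apply: le_trans cond.
  rewrite -mulrA -natrM ler_wpM2l ?ler_nat ?vol_ge_card //.
  exact/ltW/conductance_gt0.
have cardE := card_spread1 S m; rewrite -/N in cardE; split=> hS.
  by rewrite cardE natrD mulrDl mul1r lerD2l gain.
have : alpha * #|~: S|%:R <= N%:R.
  by apply: gain; [have := volC S; lia | exact: cutC].
have -> : #|~: S| = (#|~: spread1 S m| + N)%N.
  by have := cardsC S; have := cardsC (spread1 S m); lia.
by rewrite natrD; lra.
Qed.

Lemma max_degree_gt0 : (0 < #|G|)%N -> (0 < max_degree G)%N.
Proof.
case/card_gt0P => u _; apply: leq_trans min_gt0 _.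
exact: leq_trans (min_degree_le u) (leq_max_degree u).
Qed.

Lemma alpha_gt0 : (0 < #|G|)%N -> 0 < alpha.
Proof.
move=> /max_degree_gt0 max_gt0.
by rewrite divr_gt0 ?mulr_gt0 ?conductance_gt0 ?ltr0n ?double_gt0.
Qed.

Lemma alpha_le_half : (0 < #|G|)%N -> alpha <= 1 / 2.
Proof.
move=> n0; have max_gt0 := max_degree_gt0 n0; have /card_gt0P[u _] := n0.
have le_deg : (min_degree G <= max_degree G)%N.
  exact: leq_trans (min_degree_le u) (leq_max_degree u).
rewrite ler_pdivrMr ?ltr0n ?double_gt0 //.
apply: (@le_trans _ _ (1 * (max_degree G)%:R)).
  by rewrite ler_pM ?ler_nat ?conductance_le1 // ltW // conductance_gt0.
by rewrite -muln2 natrM; lra.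
Qed.

(** Growth is guaranteed only up to half of the volume, hence the alternative; once reached,
    heaviness persists because informed sets only grow. *)
Lemma spread_to_heavy root T : exists ms,
  [/\ all matching ms, size ms = T &
      heavy (spread [set root] ms) \/ (1 + alpha) ^+ T <= #|spread [set root] ms|%:R].
Proof.
have n0 : (0 < #|G|)%N by apply/card_gt0P; exists root.
elim: T => [|T [ms [mms sms IH]]].
  by exists [::]; split=> //; right; rewrite expr0 /= cards1.
have [m mm [grow _]] := spread1_growth (spread [set root] ms) (max_degree_gt0 n0).
exists (rcons ms m); rewrite all_rcons mm mms size_rcons sms spread_rcons; split=> //.
have sub : spread [set root] ms \subset spread1 (spread [set root] ms) m.
  by apply/subsetP => u uS; rewrite inE uS.
have [hS|lS] := leqP (vol [set: G]) (vol (spread [set root] ms)).*2.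
  by left; apply: leq_trans hS _; rewrite leq_double volS.
right; case: IH => [|IH]; first by lia.
apply: le_trans (grow (ltnW lS)); rewrite exprS ler_wpM2l //.
by have := alpha_gt0 n0; lra.
Qed.

(** Heaviness is carried through the induction because the shrinking of the uninformed set requires
    it in every round. *)
Lemma spread_from_heavy root ms k : all matching ms -> heavy (spread [set root] ms) ->
  exists ms', [/\ all matching ms', size ms' = (size ms + k)%N,
    heavy (spread [set root] ms') &
    #|~: spread [set root] ms'|%:R <= (1 - alpha) ^+ k * #|G|%:R].
Proof.
move=> mms hms; have n0 : (0 < #|G|)%N by apply/card_gt0P; exists root.
elim: k => [|k [ms' [mms' sms' hms' IH]]].
  by exists ms; rewrite addn0 expr0 mul1r ler_nat max_card.
have [m mm [_ shrink]] := spread1_growth (spread [set root] ms') (max_degree_gt0 n0).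
exists (rcons ms' m); rewrite all_rcons mm mms' size_rcons sms' spread_rcons addnS.
split=> //.
  apply: leq_trans hms' _; rewrite leq_double volS //.
  by apply/subsetP => u uS; rewrite inE uS.
apply: le_trans (shrink hms') _; rewrite exprS -(mulrA (1 - _)) ler_wpM2l //.
by have := alpha_le_half n0; lra.
Qed.

(** The same [T] serves both phases: growth by [(1 + alpha) ^+ T] would exceed [#|G|], so the set
    becomes heavy; then fewer than [((1 - alpha) * (1 + alpha)) ^+ T <= 1] nodes remain uninformed,
    that is, none. *)
Lemma spread_full root T : #|G|%:R < (1 + alpha) ^+ T -> exists ms,
  [/\ all matching ms, size ms = (T + T)%N & spread [set root] ms = [set: G]].
Proof.
move=> nT; have n0 : (0 < #|G|)%N by apply/card_gt0P; exists root.
have [ms [mms sms]] := spread_to_heavy root T.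
case=> [hms|]; last first.
  by move/(lt_le_trans nT); rewrite ltr_nat ltnNge max_card.
have [ms' [mms' sms' _ small]] := spread_from_heavy T mms hms.
exists ms'; split=> //; first by rewrite sms' sms.
apply/setP => u; rewrite inE; apply: contraTT small => uS.
have a0 := alpha_gt0 n0; have a2 := alpha_le_half n0.
rewrite -ltNge; apply: (@lt_le_trans _ _ 1); last first.
  by rewrite ler1n; apply/card_gt0P; exists u; rewrite inE.
have T0 : 0 < (1 - alpha) ^+ T by rewrite exprn_gt0 //; lra.
apply: (@lt_le_trans _ _ ((1 - alpha) ^+ T * (1 + alpha) ^+ T)).
  by rewrite ltr_pM2l.
rewrite -exprMn exprn_ile1 //; first by rewrite mulr_ge0; lra.
by nra.
Qed.

Local Notation expR := sequences.expR.

(** Since [expR (alpha / 2) <= 1 + alpha], any [T] above [2 * (ln #|G|%:R / alpha)] works. *)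
Lemma rounds_bound : (1 < #|G|)%N -> exists T : nat,
  #|G|%:R < (1 + alpha) ^+ T /\ T%:R <= 3 * (ln #|G|%:R / alpha).
Proof.
move=> n1; have n0 := ltnW n1.
have a0 := alpha_gt0 n0; have a2 := alpha_le_half n0.
set a := alpha in a0 a2 *; set L : R := ln _.
(* Invert [1 - a / 2 <= expR (- (a / 2))] and use [1 <= (1 - a / 2) * (1 + a)], valid as
   [a <= 1 / 2]. *)
have exp_a : expR (a / 2) <= 1 + a.
  have := expR_ge1Dx (- (a / 2)); rewrite expRN => h.
  have e0 := expR_gt0 (a / 2).
  have : expR (a / 2) * (1 - a / 2) <= 1.
    by rewrite -ler_pdivlMl // mulr1.
  by nra.
have L_half : 1 / 2 <= L.
  have h2 : expR (1 / 2) <= 2 :> R.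
    have := expR_ge1Dx (- (1 / 2) : R); rewrite expRN => h.
    have e0 := expR_gt0 (1 / 2 : R).
    have : expR (1 / 2) * (1 - 1 / 2) <= 1 :> R by rewrite -ler_pdivlMl // mulr1.
    by lra.
  rewrite -(expRK (1 / 2)) ler_ln ?posrE ?expR_gt0 ?ltr0n //.
  by apply: le_trans h2 _; rewrite (ler_nat R 2).
(* This absorbs the [+ 1] of rounding up, turning the factor 2 into 3. *)
have La0 : 1 <= L / a by rewrite ler_pdivlMr // mul1r; lra.
exists (Num.trunc (2 * (L / a))).+1; split.
  rewrite -[ltLHS]lnK ?posrE ?ltr0n // -/L.
  set T := _.+1; apply: (@lt_le_trans _ _ (expR (a / 2) ^+ T)); last first.
    by apply: lerXn2r exp_a; rewrite nnegrE; [exact: ltW (expR_gt0 _) | lra].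
  rewrite -expRM_natr ltr_expR.
  have := truncnS_gt (2 * (L / a)); rewrite -/T mulrA ltr_pdivrMr //; lra.
have : (Num.trunc (2 * (L / a)))%:R <= 2 * (L / a) by rewrite truncn_le; lra.
by rewrite -natr1; lra.
Qed.

End Broadcast.

(** * Optimal algorithms and the two bounds *)

(** Worst-case round numbers are naturals, so a least one is attained; its algorithm also meets
    every later deadline by [solved_mono]. *)
Lemma optimal_exists (G : sgraph) (A : algorithm G) (t : nat) :
  solves_within A t ->
  exists2 A' : algorithm G, optimal A' &
    exists2 t', solves_within A' t' & (t' <= t)%N.
Proof.
move=> At; pose P k := `[< exists B : algorithm G, solves_within B k >].
have exP : exists k, P k by exists t; apply/asboolP; exists A.
case: (ex_minnP exP) => k /asboolP[B Bk] kmin; exists B => [B' t' B't' s c|].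
  by apply: solved_mono (Bk s c); apply: kmin; apply/asboolP; exists B'.
by exists k => //; apply: kmin; apply/asboolP; exists A.
Qed.

Theorem theorem2 (R : realType) :
  (exists2 c : R, 0 < c &
     forall delta Delta : nat, (1 <= delta)%N -> (delta <= Delta)%N ->
     exists G : sgraph,
       [/\ connected_graph G, min_degree G = delta, max_degree G = Delta &
         forall (A : algorithm G) (source : G) (coins : G -> nat -> bool)
                (t : nat),
           solved A source coins t ->
           c * (Delta%:R / (delta%:R * conductance G R)) <= t%:R])
  /\
  (exists2 C : R, 0 < C &
     forall delta Delta : nat, (1 <= delta)%N -> (delta <= Delta)%N ->
     forall G : sgraph,
       connected_graph G -> min_degree G = delta -> max_degree G = Delta ->
       exists2 A : algorithm G, optimal A &
         exists2 t : nat, solves_within A t &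
           t%:R <= C * (Delta%:R / (delta%:R * conductance G R) * ln #|G|%:R)).
Proof.
split.
  exists (1 / 2); first by lra.
  move=> d D d1 dD; have D1 := leq_trans d1 dD.
  exists (biclique d D); split.
  - exact: biclique_connected.
  - exact: biclique_min_degree.
  - exact: biclique_max_degree.
  move=> A source coins t solved_t.
  pose L : {set biclique d D} := [set x | in_left x].
  have cover (u v : biclique d D) : edge u v -> (u \in L) || (v \in L).
    by rewrite !inE; case: u v => [i|j] [i'|j'].
  have cardL : #|L| = d.
    rewrite card_sum_set [X in (_ + X)%N](_ : _ = 0%N).
      rewrite addn0 (_ : [set _ | _] = setT) ?cardsT ?card_ord //.
      by apply/setP=> i; rewrite !inE.
    by apply: eq_card0 => j; rewrite !inE.
  have := card_informed_cover A source coins t cover.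
  rewrite solved_t cardsT card_sum !card_ord cardL => nt.
  (* From [d + D <= 1 + t * d], the source being paid for by [1 <= d]. *)
  have Dt : (D <= t * d)%N by lia.
  have := biclique_conductance d D R; set phi := conductance _ _ => phi2.
  have d0 : 0 < d%:R :> R by rewrite ltr0n.
  rewrite mulrA ler_pdivrMr; last by rewrite mulr_gt0 //; lra.
  have : D%:R <= t%:R * d%:R :> R by rewrite -natrM ler_nat.
  have : t%:R * d%:R * (1 / 2) <= t%:R * d%:R * phi.
    by rewrite ler_wpM2l // mulr_ge0 ?ler0n.
  by rewrite [t%:R * (_ * _)]mulrA; lra.
(* The product of 4 (two phases of [T] rounds, run backwards and forwards), 3 (from [rounds_bound])
   and 2 (from the denominator of [alpha]). *)
exists 24; first by lra.
move=> d D d1 dD G conG minG maxG.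
have min0 : (0 < min_degree G)%N by rewrite minG.
(* A single vertex would have degree 0, against [1 <= D]. *)
have n1 : (1 < #|G|)%N.
  rewrite ltnNge; apply/negP => n1.
  have : (max_degree G <= 0)%N.
    apply/bigmax_leqP => u _; rewrite leqn0 cards_eq0; apply/eqP/setP => v.
    by rewrite !inE (card_le1_eqP n1 v u) // edge_irr.
  by rewrite maxG; lia.
have /card_gt0P[root _] := ltnW n1.
have [T [nT TL]] := rounds_bound R conG min0 n1.
have [ms [mms sms full]] := spread_full conG min0 root nT.
have [A optA [t At tT]] := optimal_exists (solves_gather_broadcast mms full).
exists A => //; exists t => //.
have : t%:R <= 4 * T%:R :> R.
  by rewrite -(natrM R 4) ler_nat; move: tT; rewrite sms; lia.
have phi0 := conductance_gt0 R conG.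
have d0 : 0 < d%:R :> R by rewrite ltr0n.
have D0 : 0 < D%:R :> R by rewrite ltr0n (leq_trans d1).
move: TL; rewrite minG maxG -mul2n natrM.
set phi := conductance G R in phi0 *; set l := ln _.
have -> : l / (phi * d%:R / (2 * D%:R)) = 2 * (D%:R / (d%:R * phi) * l).
  by field; rewrite !gt_eqF.
by lra.
Qed.
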